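(* Let $R$ be a ring with proper involution $*$, let $m\ge 1$ be an integer and let $a\in R$. Then $a\in R^{\overline{W}_m}$ if and only if both of the following hold: (1) $a\in R^D$; (2) there exists an idempotent $p\in R$ such that $$a+p\in R\ \text{is right invertible},\quad (a^D)^*a^mp=0\quad\text{and}\quad a^DR=(1-p)R.$$ In this case, $a^{\overline{W}_m}=a^D(1-p)$.
   Context: Rings are associative with identity and $\mathbb{N}$ is the set of positive integers. An involution $*$ on $R$ satisfies $(x+y)^*=x^*+y^*$, $(xy)^*=y^*x^*$, $(x^* )^*=x$; it is proper if $x^*x=0$ implies $x=0$. An element $a\in R$ has an $m$-weak group inverse if there exist $x\in R$ and $k\in\mathbb{N}$ with $ax^2=x$, $xa^{k+1}=a^k$ and $(a^k)^*a^{m+1}x=(a^k)^*a^m$; such an $x$ is unique if it exists and is denoted $a^{\overline{W}_m}$. $R^{\overline{W}_m}$ is the set of elements of $R$ having an $m$-weak group inverse. $R^{D}$ is the set of Drazin invertible elements: $a\in R^D$ if there are $x\in R$, $k\in\mathbb{N}$ with $ax^2=x$, $ax=xa$, $a^k=xa^{k+1}$; this unique $x$ is denoted $a^D$. *)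

(* Defs.v *)
From HB Require Import structures.
From mathcomp Require Import all_boot all_order all_algebra.
From mathcomp Require Import boolp classical_sets.

Set Implicit Arguments.
Unset Strict Implicit.
Unset Printing Implicit Defensive.

Import GRing.Theory.
Local Open Scope ring_scope.
Local Open Scope classical_set_scope.

Section Defs.
(* [pzRingType]: associative rings with identity, the zero ring included *)
Variable R : pzRingType.
Implicit Types (star : R -> R) (a p x y : R) (m k : nat).

Record involution star : Prop := Involution {
  starD : forall x y, star (x + y) = star x + star y;
  starM : forall x y, star (x * y) = star y * star x;
  starK : involutive star
}.

Definition proper_involution star : Prop := forall x, star x * x = 0 -> x = 0.

Definition is_m_weak_group_inverse star m a x : Prop :=
  exists k, [/\ (0 < k)%N, a * x ^+ 2 = x, x * a ^+ k.+1 = a ^+ k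
    & star (a ^+ k) * a ^+ m.+1 * x = star (a ^+ k) * a ^+ m].

Definition m_weak_group_invertible star m a : Prop :=
  exists x, is_m_weak_group_inverse star m a x.

(* Equal to 0 when there is no such inverse; see
   [m_weak_group_inverse_unique] for uniqueness. *)
Definition m_weak_group_inverse star m a : R :=
  xget 0 [set x | is_m_weak_group_inverse star m a x].

Definition is_Drazin_inverse a x : Prop :=
  exists k, [/\ (0 < k)%N, a * x ^+ 2 = x, a * x = x * a
    & a ^+ k = x * a ^+ k.+1].

Definition Drazin_invertible a : Prop := exists x, is_Drazin_inverse a x.

(* Equal to 0 when there is no such inverse; see [Drazin_inverse_unique] for
   uniqueness. *)
Definition Drazin_inverse a : R := xget 0 [set x | is_Drazin_inverse a x].

Definition idempotent_elt p : Prop := p * p = p.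

Definition right_invertible x : Prop := exists y, x * y = 1.

Definition principal_right_ideal x : set R := [set x * r | r in [set: R]].

Lemma absorb_expr a u k n :
  u * a ^+ k.+1 = a ^+ k -> (k <= n)%N -> u * a ^+ n.+1 = a ^+ n.
Proof. by move=> e /subnKC <-; rewrite -addSn !exprD mulrA e. Qed.

Lemma outer_expr a u n : a * u ^+ 2 = u -> u = a ^+ n * u ^+ n.+1.
Proof.
move=> e; elim: n => [|n IH]; first by rewrite expr0 mul1r expr1.
have e1 : u ^+ n.+1 = a * u ^+ n.+2.
  by rewrite exprS -{1}e -mulrA -exprD.
by rewrite [LHS]IH e1 mulrA -exprSr.
Qed.

Lemma Drazin_inverse_unique a x y :
  is_Drazin_inverse a x -> is_Drazin_inverse a y -> x = y.
Proof.
move=> [k [_ x1 x2 x3]] [l [_ y1 y2 y3]].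
pose n := maxn k l.
have hx : x * a ^+ n.+1 = a ^+ n := absorb_expr (esym x3) (leq_maxl _ _).
have hy : y * a ^+ n.+1 = a ^+ n := absorb_expr (esym y3) (leq_maxr _ _).
have cx : GRing.comm (a ^+ n) (x ^+ n.+1).
  exact/commr_sym/commrX/commr_sym/commrX.
have cy : GRing.comm y (a ^+ n.+1) by apply/commrX.
transitivity (x * a * y).
  by rewrite {1 2}(outer_expr n x1) cx -!mulrA (mulrA _ a) -exprSr -cy hy.
rewrite {2}(outer_expr n y1) {1}(outer_expr n y1).
by rewrite mulrA -(mulrA x) -exprS hx.
Qed.

Lemma m_weak_group_inverse_unique star m a x y :
  involution star -> proper_involution star ->
  is_m_weak_group_inverse star m a x -> is_m_weak_group_inverse star m a y ->
  x = y.
Proof.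
move=> inv pr [k [_ x1 x2 x3]] [l [_ y1 y2 y3]].
pose n := maxn k l.
have lift j u : star (a ^+ j) * a ^+ m.+1 * u = star (a ^+ j) * a ^+ m ->
    (j <= n)%N -> star (a ^+ n) * a ^+ m.+1 * u = star (a ^+ n) * a ^+ m.
  move=> e /subnKC <-; rewrite exprD (starM inv) -!mulrA; congr (_ * _).
  by rewrite mulrA.
have hx : x * a ^+ n.+1 = a ^+ n := absorb_expr x2 (leq_maxl _ _).
have zE : x - y = a ^+ n * (x ^+ n.+1 - y ^+ n.+1).
  by rewrite mulrBr -!outer_expr.
have z0 : a ^+ m.+1 * (x - y) = 0.
  have tE : a ^+ m.+1 * (x - y)
      = a ^+ n * (a ^+ m.+1 * (x ^+ n.+1 - y ^+ n.+1)).
    by rewrite zE !mulrA -!exprD addnC.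
  have t0 : star (a ^+ n) * (a ^+ m.+1 * (x - y)) = 0.
    rewrite mulrA mulrBr.
    by rewrite (lift k) ?leq_maxl // (lift l) ?leq_maxr // subrr.
  by apply: pr; rewrite [in star _]tE (starM inv) -mulrA t0 mulr0.
have xa j : x ^+ j * a ^+ (j + n) = a ^+ n.
  elim: j => [|j IH]; first by rewrite mul1r.
  by rewrite exprSr addSn -mulrA (absorb_expr hx) // leq_addl.
apply/eqP; rewrite -subr_eq0; apply/eqP.
by rewrite zE -(xa m.+1) exprD -!mulrA -zE z0 mulr0.
Qed.

End Defs.

(* Main.v *)
(* If x is an m-weak group inverse of a of index k, then a^D = x^(k+1) a^k and
   p = 1 - ax works: e = ax is idempotent with eR = a^D R, and a + 1 - e is
   block upper triangular for R = eR + (1-e)R, with diagonal blocks a on eR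
   (right inverse x) and 1 + w on (1-e)R, where w = (1-e)a is nilpotent.
   Conversely, eR = a^D R for e = 1 - p gives a a^D e = e and e a^D = a^D, from
   which the equations for a^D e follow. *)
Require Import Defs.
From HB Require Import structures.
From mathcomp Require Import all_boot all_order all_algebra.
From mathcomp Require Import boolp classical_sets.

Set Implicit Arguments.
Unset Strict Implicit.
Unset Printing Implicit Defensive.

Import GRing.Theory.
Local Open Scope ring_scope.

Section Lemmas.
Variable R : pzRingType.
Implicit Types (star : R -> R) (a d p w x : R) (m k n : nat).

Lemma Drazin_inverseE a d : is_Drazin_inverse a d -> Drazin_inverse a = d.
Proof.
move=> ad; apply: xget_unique => // y ay.
exact: (Drazin_inverse_unique ay ad).
Qed.

Lemma m_weak_group_inverseE star m a x :
  involution star -> proper_involution star ->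
  is_m_weak_group_inverse star m a x -> m_weak_group_inverse star m a = x.
Proof.
move=> inv pr ax; apply: xget_unique => // y ay.
exact: (m_weak_group_inverse_unique inv pr ay ax).
Qed.

(** The inverse is the finite geometric series in [- w], by the factorization of
    [(- w) ^+ k - 1]. *)
Lemma nilpotent_right_invertible w k : w ^+ k = 0 -> right_invertible (1 + w).
Proof.
move=> wk; exists (\sum_(i < k) (- w) ^+ i).
have := subrX1 (- w) k.
rewrite exprNn wk mulr0 sub0r -opprD mulNr => /oppr_inj.
by rewrite addrC.
Qed.

Lemma absorb_exprX a x k n :
  x * a ^+ k.+1 = a ^+ k -> x ^+ n * a ^+ (n + k) = a ^+ k.
Proof.
move=> xa; elim: n => [|n IH]; first by rewrite mul1r.
by rewrite exprSr addSn -mulrA (absorb_expr xa) // leq_addl.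
Qed.

Lemma outer_exprS a x n : a * x ^+ 2 = x -> a * x ^+ n.+2 = x ^+ n.+1.
Proof. by move=> ax; rewrite -(addn2 n) addnC exprD mulrA ax -exprS. Qed.

(** Multiplying by [a] on either side gives [x ^+ k * a ^+ k]: on the right [xa] absorbs one [x], on
    the left [ax] does. *)
Lemma Drazin_inverse_of_outer a x k :
  (0 < k)%N -> a * x ^+ 2 = x -> x * a ^+ k.+1 = a ^+ k ->
  is_Drazin_inverse a (x ^+ k.+1 * a ^+ k).
Proof.
move=> k_gt0 ax xa; exists k.
have da : x ^+ k.+1 * a ^+ k * a = x ^+ k * a ^+ k.
  by rewrite -mulrA -exprSr exprSr -mulrA xa.
have ad : a * (x ^+ k.+1 * a ^+ k) = x ^+ k * a ^+ k.
  (* [a] cancels against [x ^+ k.+1] only when this power is at least 2, hence [0 < k]. *)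
  by rewrite mulrA; case: k k_gt0 {da xa} => // k _; rewrite outer_exprS.
split=> //; first 2 last.
- by rewrite -mulrA -exprD addnC (absorb_exprX _ xa).
- rewrite expr2 mulrA ad -!mulrA (mulrA (a ^+ k)) -(outer_expr k ax).
  by rewrite mulrA -exprSr.
- by rewrite ad da.
Qed.

Lemma outer_mul_expr a x k :
  a * x ^+ 2 = x -> x * a ^+ k.+1 = a ^+ k -> a * x * a ^+ k = a ^+ k.
Proof. by move=> ax xa; rewrite -xa -mulrA (mulrA x x) -expr2 mulrA ax. Qed.

Lemma outer_mulE a x k : a * x ^+ 2 = x -> a * x = a ^+ k * (a * x ^+ k.+1).
Proof. by move=> ax; rewrite mulrA -exprSr exprS -mulrA -outer_expr. Qed.

(** [a * x] fixes [a ^+ k] from the left and itself lies in [a ^+ k * R]. *)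
Lemma outer_idempotent a x k :
  a * x ^+ 2 = x -> x * a ^+ k.+1 = a ^+ k -> idempotent_elt (a * x).
Proof.
move=> ax xa; rewrite /idempotent_elt [X in _ * X](outer_mulE k ax).
by rewrite mulrA (outer_mul_expr ax xa) -outer_mulE.
Qed.

Lemma idempotent_compl p : idempotent_elt p -> idempotent_elt (1 - p).
Proof.
by move=> pp; rewrite /idempotent_elt mulrBr mulr1 mulrBl mul1r pp subrr subr0.
Qed.

Lemma right_invertible_add_compl a x k :
  (0 < k)%N -> a * x ^+ 2 = x -> x * a ^+ k.+1 = a ^+ k ->
  right_invertible (a + (1 - a * x)).
Proof.
move=> k_gt0 ax xa; set e := a * x; set f := 1 - e.
have ex : e * x = x by rewrite -mulrA -expr2.
have ek : e * a ^+ k = a ^+ k := outer_mul_expr ax xa.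
have ee : e * e = e := outer_idempotent ax xa.
have [c eE] : exists c, e = a ^+ k * c by eexists; exact: outer_mulE ax.
have axE : a * x = e by [].
clearbody e.
have fk : f * a ^+ k = 0 by rewrite mulrBl mul1r ek subrr.
(* The zero block: [e] lies in [a ^+ k * R], which [a] preserves and [f] kills. *)
have fae : f * a * e = 0.
  by rewrite eE mulrA -(mulrA f) -exprS exprSr mulrA fk !mul0r.
have ff : f * f = f := idempotent_compl ee.
have fx : f * x = 0 by rewrite mulrBl mul1r ex subrr.
have faf : f * a * f = f * a by rewrite mulrBr mulr1 fae subr0.
have fa_exp n : (f * a) ^+ n.+1 = f * a ^+ n.+1.
  elim: n => [|n IH]; first by rewrite !expr1.
  by rewrite exprS IH mulrA faf -mulrA -exprS.
(* [fa_exp] covers positive exponents only, so [0 < k] is used here. *)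
have /nilpotent_right_invertible[v wv] : (f * a) ^+ k = 0.
  by case: k k_gt0 fk {ax xa ek eE} (fa_exp k.-1) => // k _ fk ->.
(* As [f * a * f = f * a], the [f]-part of the left side is [f * (1 + f * a) * v = f]. *)
have afv : (a + f) * f * v = f + e * a * f * v.
  have {1}-> : a = e * a + f * a by rewrite -mulrDl subrKC mul1r.
  rewrite -addrA mulrDl mulrDl [LHS]addrC; congr (_ + _).
  rewrite mulrDl faf ff -[X in _ = X]mulr1 -wv mulrA mulrDr mulr1.
  by rewrite (mulrA f) ff addrC.
have afx : (a + f) * x = e by rewrite mulrDl fx addr0 axE.
set g := e * a * f * v in afv.
have eg : e * g = g by rewrite /g !mulrA ee.
(* Back substitution: [a + f] sends [f * v] to [f + g] and [x] to [e]; the correction [- x * g]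
   removes the off-diagonal term [g]. *)
exists (x * (1 - g) + f * v).
rewrite mulrDr !mulrA afx afv mulrBr mulr1 eg.
by rewrite (addrC f) addrA subrK subrKC.
Qed.

Lemma m_weak_group_inverse_Drazin star m a x :
  involution star -> is_m_weak_group_inverse star m a x ->
  exists2 d, is_Drazin_inverse a d &
    exists p, [/\ idempotent_elt p, right_invertible (a + p),
      star d * a ^+ m * p = 0
    & principal_right_ideal d = principal_right_ideal (1 - p)].
Proof.
move=> inv [k [k_gt0 ax xa wx]].
have ad := Drazin_inverse_of_outer k_gt0 ax xa.
(* From here on [d] is any Drazin inverse, with its own exponent [l]. *)
exists (x ^+ k.+1 * a ^+ k) => //; move: (x ^+ _ * _) ad => d [l [_ ad _ dl]].
exists (1 - a * x); split.
- exact/idempotent_compl/outer_idempotent/xa.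
- exact: right_invertible_add_compl k_gt0 ax xa.
(* Since [d = a ^+ k * d ^+ k.+1], [star d] is a left multiple of [star (a ^+ k)], and [wx]
   applies. *)
- rewrite (outer_expr k ad) (starM inv) -!mulrA (mulrA (star (a ^+ k))).
  by rewrite mulrBr mulr1 mulrA -(mulrA _ (a ^+ m)) -exprSr wx subrr mulr0.
rewrite subKr; apply/seteqP; split=> _ [r _ <-].
- exists (d * r) => //.
  rewrite mulrA {1}(outer_expr k ad) mulrA.
  by rewrite (outer_mul_expr ax xa) -outer_expr.
- exists (a ^+ l.+1 * (a * x ^+ l.+1) * r) => //.
  by rewrite !mulrA -dl -(mulrA (a ^+ l)) -outer_mulE.
Qed.

Lemma is_m_weak_group_inverse_mul_compl star m a d p :
  involution star -> is_Drazin_inverse a d -> idempotent_elt p ->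
  star d * a ^+ m * p = 0 ->
  principal_right_ideal d = principal_right_ideal (1 - p) ->
  is_m_weak_group_inverse star m a (d * (1 - p)).
Proof.
move=> inv [k [k_gt0 ad adC dk]] /idempotent_compl; set q := 1 - p => qq dp dR.
(* Each generator lies in the other's ideal: [d = q * s] and [q = d * r]. *)
have [s _ dE] : principal_right_ideal q d.
  by rewrite -dR; exists 1; rewrite ?mulr1.
have [r _ qE] : principal_right_ideal d q.
  by rewrite dR; exists 1; rewrite ?mulr1.
have qd : q * d = d by rewrite -dE mulrA qq.
have adq : a * d * q = q by rewrite -qE !mulrA -(mulrA a) -expr2 ad.
have qk : q * a ^+ k = a ^+ k by rewrite dk mulrA qd.
exists k; split=> //.
- by rewrite expr2 -(mulrA d) (mulrA q) qd !mulrA -(mulrA a) -expr2 ad.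
- by rewrite exprSr -mulrA (mulrA q) qk -exprSr -dk.
(* [a ^+ k = d * a ^+ k.+1] makes [star (a ^+ k)] a left multiple of [star d]. *)
- have akm : star (a ^+ k) * a ^+ m * p = 0.
    by rewrite dk (starM inv) -!mulrA (mulrA (star d)) dp mulr0.
  by rewrite exprSr -!mulrA (mulrA a) adq mulrA mulrBr mulr1 akm subr0.
Qed.

End Lemmas.

Theorem theorem3p5 (R : pzRingType) (star : R -> R)
  (star_inv : involution star) (star_proper : proper_involution star)
  (m : nat) (m_ge1 : (1 <= m)%N) (a : R) :
  (m_weak_group_invertible star m a <->
     Drazin_invertible a /\
     exists p : R,
       [/\ idempotent_elt p, right_invertible (a + p),
           star (Drazin_inverse a) * a ^+ m * p = 0
         & principal_right_ideal (Drazin_inverse a)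
             = principal_right_ideal (1 - p)]) /\
  (m_weak_group_invertible star m a ->
     forall p : R,
       idempotent_elt p -> right_invertible (a + p) ->
       star (Drazin_inverse a) * a ^+ m * p = 0 ->
       principal_right_ideal (Drazin_inverse a)
         = principal_right_ideal (1 - p) ->
       m_weak_group_inverse star m a = Drazin_inverse a * (1 - p)).
Proof.
have compl_inv d p : is_Drazin_inverse a d -> idempotent_elt p ->
    star (Drazin_inverse a) * a ^+ m * p = 0 ->
    principal_right_ideal (Drazin_inverse a) = principal_right_ideal (1 - p) ->
    is_m_weak_group_inverse star m a (Drazin_inverse a * (1 - p)).
  move=> ad; rewrite (Drazin_inverseE ad).
  exact: is_m_weak_group_inverse_mul_compl.
split; first split.
- move=> [x /(m_weak_group_inverse_Drazin star_inv)[d ad ex_p]].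
  by rewrite (Drazin_inverseE ad); split; first exists d.
- move=> [[d ad] [p [pp _ dp dR]]]; exists (Drazin_inverse a * (1 - p)).
  exact: compl_inv ad pp dp dR.
(* The first implication supplies a Drazin inverse, so [Drazin_inverse a] is not a mere default
   value; uniqueness then gives the formula. *)
- move=> [x /(m_weak_group_inverse_Drazin star_inv)[d ad _]] p pp _ dp dR.
  exact: m_weak_group_inverseE (compl_inv _ _ ad pp dp dR).
Qed.
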